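(* Let $r\in\mathbb N$. For $k=0,1,\dots,r$, let $i_k,j_k\in\mathbb N$, $c_k\in\mathbb R\setminus\{0\}$, and $\bm a_k\in\mathbb R^{i_k}$, $\bm b_k\in\mathbb R^{j_k}$. Let $n\in\mathbb N$, and assume that no entry of any of the tuples $\bm a_k$, $\bm b_k$ ($k=0,\dots,r$) belongs to $\{0,-1,\dots,-n+1\}$. Then, up to a nonzero multiplicative constant (independent of $x$ and explicitly computable in terms of the parameters), $$F_{j_0: j_1 ;\dots; j_r}^{i_0+1: i_1 ;\dots; i_r}\left[\left.\begin{array}{c}-n,\bm a_0:\bm a_1 ; \dots ; \bm a_r \\ \bm b_0:\bm b_1 ;\dots ; \bm b_r\end{array} \right| c_1 x,c_2x,\dots,c_rx \right] \simeq \left[q_0\boxtimes_n \left(q_1 \boxplus_n \cdots \boxplus_n q_r \right) \right]^*(x),$$ where $$q_0(x)={}_{j_0+1}F_{i_0}\left(-n, -\bm b_0-n+1;\ -\bm a_0-n+1;\ (-1)^{i_0+j_0}x\right),$$ $$q_l(x)={}_{j_l+1}F_{i_l}\left(-n, -\bm b_l-n+1;\ -\bm a_l-n+1;\ (-1)^{i_l+j_l}\frac{x}{c_l}\right),\qquad l=1,\dots,r.$$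
   Context: Notation: $\mathbb N=\{1,2,\dots\}$. Rising factorial: $(a)^{\overline{0}}=1$, $(a)^{\overline{k}}=a(a+1)\cdots(a+k-1)$; falling factorial: $(a)^{\underline{0}}=1$, $(a)^{\underline{k}}=a(a-1)\cdots(a-k+1)$. For a tuple $\bm a=(a_1,\dots,a_i)$, $(\bm a)^{\overline{k}}=\prod_{s}(a_s)^{\overline{k}}$; adding a scalar to a tuple means adding it to each component. $p\simeq q$ means that $p$ and $q$ coincide up to a nonzero multiplicative constant. Hypergeometric polynomial: for $\bm a\in\mathbb R^i$, $\bm b\in\mathbb R^j$, ${}_{i+1}F_j(-n,\bm a;\bm b;x)=\sum_{k=0}^n \frac{(-n)^{\overline{k}}(\bm a)^{\overline{k}}}{(\bm b)^{\overline{k}}}\frac{x^k}{k!}$ (the sum stops at $k=n$). Kampé de Fériet polynomial: $$F_{j_0: j_1 ;\dots; j_r}^{i_0+1: i_1 ;\dots; i_r}\left[\left.\begin{array}{c}-n,\bm a_0:\bm a_1 ; \dots ; \bm a_r \\ \bm b_0:\bm b_1 ;\dots ; \bm b_r\end{array} \right| x_1,\dots,x_r \right]=\sum_{k=0}^{n}\frac{(-n)^{\overline{k}}(\bm a_0)^{\overline{k}}}{(\bm b_0)^{\overline{k}}}\sum_{l_1+\cdots+l_r=k}\ \prod_{s=1}^r\frac{(\bm a_s)^{\overline{l_s}}\,x_s^{l_s}}{(\bm b_s)^{\overline{l_s}}\, l_s!},$$ the inner sum running over nonnegative integers $l_1,\dots,l_r$. Finite free convolutions: for polynomials of degree at most $n$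 written $p(x)=\sum_{j=0}^n x^{n-j}(-1)^je_j(p)$, $q(x)=\sum_{j=0}^n x^{n-j}(-1)^je_j(q)$, the polynomials $p\boxtimes_n q$ and $p\boxplus_n q$ (of degree at most $n$, written in the same form) are defined by $$e_k(p\boxtimes_n q)=\binom nk^{-1}e_k(p)e_k(q),\qquad e_k(p\boxplus_n q)=(n)^{\underline{k}}\sum_{i+j=k}\frac{e_i(p)}{(n)^{\underline{i}}}\frac{e_j(q)}{(n)^{\underline{j}}}.$$ Reversed polynomial (with respect to degree $n$): $p^*(z)=z^n\overline{p(1/\overline z)}$; for real coefficients, $p^*(x)=x^np(1/x)$. *)

(* Defs.v *)
From mathcomp Require Import all_boot all_order all_algebra.
From mathcomp Require Import reals.

Set Implicit Arguments.
Unset Strict Implicit.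
Unset Printing Implicit Defensive.

Import Order.TTheory GRing.Theory Num.Theory.
Local Open Scope ring_scope.

Definition rising (R : nzRingType) (a : R) (k : nat) : R :=
  \prod_(s < k) (a + s%:R).

Definition rising_seq (R : nzRingType) (a : seq R) (k : nat) : R :=
  \prod_(t <- a) rising t k.

(* The argument x ranges over a commutative R-algebra A: with A = {poly R} and
   x = c *: 'X this is the polynomial obtained by substituting c x. *)
Definition hypergeom (R : fieldType) (A : comAlgType R) (n : nat)
    (a b : seq R) (x : A) : A :=
  \sum_(k < n.+1)
    (rising (- n%:R) k * rising_seq a k / rising_seq b k / (k`!)%:R) *: x ^+ k.

Definition kampe_de_feriet (R : fieldType) (A : comAlgType R) (n r : nat)
    (a0 b0 : seq R) (a b : 'I_r -> seq R) (x : 'I_r -> A) : A :=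
  \sum_(k < n.+1)
    (rising (- n%:R) k * rising_seq a0 k / rising_seq b0 k) *:
    \sum_(l : {ffun 'I_r -> 'I_k.+1} | (\sum_s l s)%N == k)
      \prod_(s < r)
        ((rising_seq (a s) (l s) / (rising_seq (b s) (l s) * ((l s)`!)%:R))
           *: x s ^+ l s).

(* The coefficients e_k(p) in p = \sum_k (-1)^k e_k(p) x^(n-k), and the
   polynomial with prescribed e_0, ..., e_n. *)
Definition ecoef (R : nzRingType) (n : nat) (p : {poly R}) (k : nat) : R :=
  (-1) ^+ k * p`_(n - k).

Definition epoly (R : nzRingType) (n : nat) (e : nat -> R) : {poly R} :=
  \sum_(k < n.+1) ((-1) ^+ k * e k) *: 'X^(n - k).

Definition ffmul (R : fieldType) (n : nat) (p q : {poly R}) : {poly R} :=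
  epoly n (fun k => ('C(n, k))%:R^-1 * ecoef n p k * ecoef n q k).

Definition ffadd (R : fieldType) (n : nat) (p q : {poly R}) : {poly R} :=
  epoly n (fun k => (n ^_ k)%:R *
    \sum_(i < k.+1) (ecoef n p i / (n ^_ i)%:R) *
                    (ecoef n q (k - i) / (n ^_ (k - i))%:R)).

Definition revpoly (R : nzRingType) (n : nat) (p : {poly R}) : {poly R} :=
  \poly_(k < n.+1) p`_(n - k).

Lemma coef_epoly (R : nzRingType) (n k : nat) (e : nat -> R) :
  (k <= n)%N -> (epoly n e)`_(n - k) = (-1) ^+ k * e k.
Proof.
move=> le_kn; rewrite /epoly coef_sum.
rewrite (bigD1 (Ordinal (le_kn : (k < n.+1)%N))) //= coefZ coefXn eqxx mulr1.
rewrite big1 ?addr0 // => i ne_ik; rewrite coefZ coefXn.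
case: eqP => [eq_nki|_]; last by rewrite mulr0.
case/eqP: ne_ik; apply/val_inj => /=.
by rewrite -(subKn le_kn) eq_nki subKn // -ltnS.
Qed.

Lemma ecoef_epoly (R : nzRingType) (n k : nat) (e : nat -> R) :
  (k <= n)%N -> ecoef n (epoly n e) k = e k.
Proof. by move=> le_kn; rewrite /ecoef coef_epoly // signrMK. Qed.

Lemma epoly_ecoef (R : nzRingType) (n : nat) (p : {poly R}) :
  (size p <= n.+1)%N -> epoly n (ecoef n p) = p.
Proof.
move=> le_pn; rewrite /epoly; under eq_bigr do rewrite signrMK.
rewrite (reindex_inj rev_ord_inj) /= -[RHS](coefK p) poly_def.
rewrite [RHS](big_ord_widen n.+1 (fun i => p`_i *: 'X^i)) // [RHS]big_mkcond.
apply: eq_bigr => i _; have le_in : (i <= n)%N by rewrite -ltnS.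
by rewrite subSS subKn //; case: ltnP => // le_pi; rewrite nth_default // scale0r.
Qed.

(* 'X^n is neutral for ffadd n in degree at most n, so an iterated ffadd n with
   initial value 'X^n is the plain iterated sum q_1 [+] ... [+] q_r. *)
Lemma ffaddXn (R : numFieldType) (n : nat) (p : {poly R}) :
  (size p <= n.+1)%N -> ffadd n p 'X^n = p.
Proof.
move=> le_pn; rewrite -[RHS](epoly_ecoef le_pn) /ffadd /epoly.
apply: eq_bigr => k _; congr (_ * _ *: _); have le_kn : (k <= n)%N by rewrite -ltnS.
have eX j : (j <= n)%N -> ecoef n ('X^n : {poly R}) j = (j == 0)%:R.
  move=> le_jn; rewrite /ecoef coefXn; case: j le_jn => [|j] lt_jn.
    by rewrite subn0 eqxx mulr1.
  by rewrite ltn_eqF ?mulr0 // ltn_subrL /= (leq_trans _ lt_jn).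
rewrite big_ord_recr /= subnn eX // ffactn0 divr1 mulr1 big1 => [|i _].
  by rewrite add0r mulrC divfK // pnatr_eq0 -lt0n ffact_gt0.
rewrite eX; last by rewrite (leq_trans (leq_subr _ _)).
by rewrite subn_eq0 leqNgt ltn_ord mul0r mulr0.
Qed.

Lemma horner_revpoly (R : fieldType) (n : nat) (p : {poly R}) (x : R) :
  (size p <= n.+1)%N -> x != 0 -> (revpoly n p).[x] = x ^+ n * p.[x^-1].
Proof.
move=> le_pn x0; rewrite horner_poly (horner_coef_wide _ le_pn) mulr_sumr.
rewrite (reindex_inj rev_ord_inj) /=; apply: eq_bigr => i _.
have le_in : (i <= n)%N by rewrite -ltnS.
by rewrite subSS subKn // mulrCA expfB_cond ?(negPf x0) ?exprVn.
Qed.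

(* Main.v *)
Require Import Defs.
From mathcomp Require Import all_boot all_order all_algebra.
From mathcomp Require Import reals ring.

Set Implicit Arguments.
Unset Strict Implicit.
Unset Printing Implicit Defensive.

Import Order.TTheory GRing.Theory Num.Theory.
Local Open Scope ring_scope.

(* Reversing a
   Pochhammer product, (-t-n+1)_k = (-1)^k (t)_n / (t)_(n-k), gives
   e_k(q_l) = D_l n^_k (a_l)_k / (b_l)_k c_l^k / k! with D_l independent of k (c_0 = 1).
   In the coordinates e_k / n^_k, the operation [+]_n is truncated polynomial
   multiplication, so e_k(q_1 [+] ... [+] q_r) / n^_k is the coefficient of X^k in
   a product of r polynomials, which is the inner sum over l_1 + ... + l_r = k of
   the Kampe de Feriet polynomial.  The factor (-n)_k = (-1)^k n^_k comes from
   reversing. *)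

Section Rising.
Variable R : comNzRingType.
Implicit Types (t : R) (s : seq R).

Lemma risingN t k : rising (- t) k = (-1) ^+ k * \prod_(m < k) (t - m%:R).
Proof.
rewrite -[k in (-1) ^+ k]card_ord -prodr_const -big_split /=.
by apply: eq_bigr => m _; rewrite mulN1r opprB addrC.
Qed.

Lemma rising_oppn (n k : nat) : (k <= n)%N ->
  rising (- n%:R : R) k = (-1) ^+ k * (n ^_ k)%:R.
Proof.
move=> le_kn; rewrite risingN ffact_prod natr_prod; congr (_ * _).
by apply: eq_bigr => m _; rewrite natrB // (leq_trans _ le_kn) // ltnW.
Qed.

Lemma risingD t (m k : nat) :
  rising t (m + k) = rising t m * rising (t + m%:R) k.
Proof.
rewrite /rising big_split_ord /=; congr (_ * _).
by apply: eq_bigr => s _; rewrite natrD addrA.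
Qed.

(** The last [k] factors of [rising t n], from [t + n - k] to [t + n - 1], are up to sign and in
    reverse order the factors of the shifted product. The product form avoids any division. *)
Lemma rising_reflect t (n k : nat) : (k <= n)%N ->
  rising (- t - n%:R + 1) k * rising t (n - k) = (-1) ^+ k * rising t n.
Proof.
move=> le_kn; rewrite -[in RHS](subnK le_kn) risingD mulrCA mulrC.
congr (_ * _).
have -> : - t - n%:R + 1 = - (t + n%:R - 1) by rewrite !opprD opprK.
rewrite risingN; congr (_ * _).
rewrite /rising (reindex_inj rev_ord_inj) /=; apply: eq_bigr => s _.
by rewrite !natrB // -natr1; ring.
Qed.

Lemma rising_seq_reflect s (n k : nat) : (k <= n)%N ->
  rising_seq [seq - t - n%:R + 1 | t <- s] k * rising_seq s (n - k)
  = (-1) ^+ (size s * k) * rising_seq s n.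
Proof.
move=> le_kn; rewrite /rising_seq big_map; elim: s => [|t s IHs].
  by rewrite !big_nil mul0n !mulr1.
by rewrite !big_cons /= mulSn exprD mulrACA IHs rising_reflect // mulrACA.
Qed.

End Rising.

Lemma rising_seq_neq0 (R : fieldType) (s : seq R) (n k : nat) :
    (forall t m, t \in s -> (m < n)%N -> t != - m%:R) -> (k <= n)%N ->
  rising_seq s k != 0.
Proof.
move=> s_ok le_kn; rewrite /rising_seq prodf_seq_neq0; apply/allP => t st /=.
apply/prodf_neq0 => m _.
by rewrite addr_eq0 s_ok // (leq_trans _ le_kn).
Qed.

Section FiniteFree.
Variable R : numFieldType.

Lemma coef_hypergeom (n k : nat) (s t : seq R) (d : R) : (k <= n)%N ->
  (hypergeom n s t (d *: 'X : {poly R}))`_k =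
  rising (- n%:R) k * rising_seq s k / rising_seq t k / (k`!)%:R * d ^+ k.
Proof.
move=> le_kn; rewrite /hypergeom coef_sum.
rewrite (bigD1 (Ordinal (le_kn : (k < n.+1)%N))) //=.
rewrite exprZn !coefZ coefXn eqxx mulr1 big1 ?addr0 // => m ne_mk.
rewrite exprZn !coefZ coefXn; case: eqP => [eq_km|_]; last by rewrite !mulr0.
by case/eqP: ne_mk; apply/val_inj.
Qed.

(** Since [e_k] reads the coefficient of index [n - k], reflection at [n - k] swaps the roles of [a]
    and [b] and leaves rising factorials of order [k]. The reflection signs cancel the sign in the
    argument. *)
Lemma ecoef_hypergeom (n k : nat) (a b : seq R) (d : R) :
    (forall t m, t \in a -> (m < n)%N -> t != - m%:R) ->
    (forall t m, t \in b -> (m < n)%N -> t != - m%:R) ->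
    d != 0 -> (k <= n)%N ->
  let shift (s : seq R) := [seq - t - n%:R + 1 | t <- s] in
  ecoef n (hypergeom n (shift b) (shift a)
             (((-1) ^+ (size a + size b) / d) *: 'X : {poly R})) k =
  (-1) ^+ n * rising_seq b n / rising_seq a n / d ^+ n *
  ('C(n, k)%:R * (rising_seq a k / rising_seq b k * d ^+ k)).
Proof.
move=> a_ok b_ok d0 le_kn shift; have le_mn := leq_subr k n.
rewrite /ecoef coef_hypergeom // rising_oppn // -bin_ffact natrM bin_sub //.
have shiftE (s : seq R) : (forall t m, t \in s -> (m < n)%N -> t != - m%:R) ->
    rising_seq (shift s) (n - k) =
    (-1) ^+ (size s * (n - k)) * rising_seq s n / rising_seq s k.
  move=> s_ok; apply: (mulIf (rising_seq_neq0 s_ok le_kn)).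
  by rewrite -{2}(subKn le_kn) rising_seq_reflect // divfK ?(rising_seq_neq0 s_ok).
(* A sign is its own inverse; inverting this one makes it cancel formally against its copy coming
   from the argument. *)
rewrite !shiftE // -(invr_sign _ (size b * _)) expr_div_n -exprM mulnDl exprD.
have f0 : ((n - k)`!)%:R != 0 :> R by rewrite pnatr_eq0 -lt0n fact_gt0.
have an0 := rising_seq_neq0 a_ok (leqnn n); have ak0 := rising_seq_neq0 a_ok le_kn.
have bk0 := rising_seq_neq0 b_ok le_kn.
rewrite -[in (-1) ^+ n](subnKC le_kn) -[in d ^+ n](subnK le_kn) !exprD.
have sa0 := signr_eq0 R (size a * (n - k)); have sb0 := signr_eq0 R (size b * (n - k)).
move/negbT: sa0; move/negbT: sb0; move: (expf_neq0 k d0) (expf_neq0 (n - k) d0).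
(* With [n] split as [k + (n - k)], the powers become independent variables and a rational identity
   remains. *)
move: (d ^+ k) (d ^+ (n - k)) ((-1) ^+ (size a * _)) ((-1) ^+ (size b * _)).
move: ((-1) ^+ k) ((-1) ^+ (n - k)) => s1 s2 d1 d2 sa sb d1_0 d2_0 sb0 sa0.
by field; rewrite an0 ak0 bk0 f0 d1_0 d2_0 sa0 sb0.
Qed.

Lemma ecoefXn (n k : nat) : (k <= n)%N ->
  ecoef n ('X^n : {poly R}) k = (k == 0%N)%:R.
Proof.
move=> le_kn; rewrite /ecoef coefXn; case: k le_kn => [|k] lt_kn.
  by rewrite subn0 eqxx mulr1.
by rewrite ltn_eqF ?mulr0 // ltn_subrL /= (leq_trans _ lt_kn).
Qed.

(** The neutral element ['X^n] corresponds to the polynomial 1. The truncation order [N] stays fixed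
    while the induction lowers [k]; any [N > k] retains all coefficients that matter. *)
Lemma ecoef_bigffadd (I : Type) (s : seq I) (q : I -> {poly R}) (n N k : nat) :
    (k <= n)%N -> (k < N)%N ->
  ecoef n (\big[ffadd n/'X^n]_(l <- s) q l) k =
  (n ^_ k)%:R *
  (\prod_(l <- s) \poly_(m < N) (ecoef n (q l) m / (n ^_ m)%:R))`_k.
Proof.
elim: s k => [|l s IHs] k le_kn lt_kN.
  rewrite !big_nil ecoefXn // coef1; case: k {le_kn lt_kN} => [|k] /=.
    by rewrite ffactn0 mulr1.
  by rewrite mulr0.
rewrite !big_cons ecoef_epoly // coefM; congr (_ * _); apply: eq_bigr => m _.
have le_mk : (m <= k)%N by rewrite -ltnS.
have le_kmn := leq_trans (leq_subr m k) le_kn.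
rewrite coef_poly (leq_ltn_trans le_mk) // IHs //; last first.
  by rewrite (leq_ltn_trans _ lt_kN) ?leq_subr.
by rewrite [X in _ * X]mulrAC divff ?mul1r // pnatr_eq0 -lt0n ffact_gt0.
Qed.

(** Expanding the product, the choice [l] of exponents contributes to degree [\sum_s l s] only.
    Truncating at [k.+1] gives [l] the type used in [kampe_de_feriet]. *)
Lemma coef_prod_poly (r k : nat) (u : 'I_r -> nat -> R) :
  (\prod_(s < r) \poly_(m < k.+1) u s m)`_k =
  \sum_(l : {ffun 'I_r -> 'I_k.+1} | (\sum_s l s)%N == k) \prod_s u s (l s).
Proof.
under eq_bigr do rewrite poly_def.
rewrite bigA_distr_bigA coef_sum [RHS]big_mkcond; apply: eq_bigr => l _ /=.
by rewrite scaler_prod coefZ prodrXr coefXn eq_sym; case: eqP; rewrite ?mulr1 ?mulr0.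
Qed.

Lemma kampe_de_ferietZX (n r : nat) (a0 b0 : seq R) (a b : 'I_r -> seq R)
    (c : 'I_r -> R) :
  kampe_de_feriet n a0 b0 a b (fun s => c s *: ('X : {poly R})) =
  \poly_(k < n.+1) (rising (- n%:R) k * rising_seq a0 k / rising_seq b0 k *
    \sum_(l : {ffun 'I_r -> 'I_k.+1} | (\sum_s l s)%N == k)
      \prod_(s < r) (rising_seq (a s) (l s) /
         (rising_seq (b s) (l s) * ((l s)`!)%:R) * c s ^+ l s)).
Proof.
rewrite poly_def; apply: eq_bigr => k _; rewrite -[RHS]scalerA; congr (_ *: _).
rewrite scaler_suml; apply: eq_bigr => l /eqP lk.
under eq_bigr do rewrite exprZn scalerA.
by rewrite scaler_prod prodrXr lk.
Qed.

End FiniteFree.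

Theorem theorem3p1 (R : realType) (r : nat) (r_gt0 : (0 < r)%N)
    (i j : 'I_r.+1 -> nat)
    (i_gt0 : forall k, (0 < i k)%N) (j_gt0 : forall k, (0 < j k)%N)
    (c : 'I_r.+1 -> R) (c_neq0 : forall k, c k != 0)
    (a : forall k, (i k).-tuple R) (b : forall k, (j k).-tuple R)
    (n : nat) (n_gt0 : (0 < n)%N)
    (a_ok : forall k t m, t \in a k -> (m < n)%N -> t != - m%:R)
    (b_ok : forall k t m, t \in b k -> (m < n)%N -> t != - m%:R) :
  let shift (s : seq R) := [seq - t - n%:R + 1 | t <- s] in
  let q0 : {poly R} :=
    hypergeom n (shift (b ord0)) (shift (a ord0))
      ((-1) ^+ (i ord0 + j ord0) *: 'X) in
  let q (l : 'I_r) : {poly R} :=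
    let k := lift ord0 l in
    hypergeom n (shift (b k)) (shift (a k))
      (((-1) ^+ (i k + j k) / c k) *: 'X) in
  exists2 C : R, C != 0 &
    kampe_de_feriet n (a ord0) (b ord0)
      (fun l : 'I_r => a (lift ord0 l)) (fun l : 'I_r => b (lift ord0 l))
      (fun l : 'I_r => c (lift ord0 l) *: ('X : {poly R}))
    = C *: revpoly n (ffmul n q0 (\big[ffadd n/'X^n]_(l < r) q l)).
Proof.
move=> shift q0 q.
(* The scale [d] is a separate argument, so that [q0] is covered by [d = 1]. *)
pose D k d := (-1) ^+ n * rising_seq (b k) n / rising_seq (a k) n / d ^+ n.
have D_neq0 k d : d != 0 -> D k d != 0.
  move=> d0; rewrite !mulf_neq0 ?invr_eq0 ?signr_eq0 ?expf_neq0 //.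
    exact: rising_seq_neq0 (b_ok k) (leqnn n).
  exact: rising_seq_neq0 (a_ok k) (leqnn n).
have ecoefE k d m : d != 0 -> (m <= n)%N ->
    ecoef n (hypergeom n (shift (b k)) (shift (a k))
               (((-1) ^+ (i k + j k) / d) *: 'X : {poly R})) m =
    D k d * ('C(n, m)%:R * (rising_seq (a k) m / rising_seq (b k) m * d ^+ m)).
  move=> d0 le_mn; have := ecoef_hypergeom (a_ok k) (b_ok k) d0 le_mn.
  by rewrite /= !size_tuple.
pose E := D ord0 1 * \prod_(l < r) D (lift ord0 l) (c (lift ord0 l)).
have E_neq0 : E != 0.
  rewrite mulf_neq0 ?D_neq0 ?oner_eq0 //.
  by apply/prodf_neq0 => l _; apply: D_neq0.
(* Both convolutions are bilinear, so the constants of all the [q]'s factor out as [E]. *)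
exists E^-1; first by rewrite invr_eq0.
rewrite kampe_de_ferietZX; apply/polyP => k; rewrite coefZ !coef_poly.
case: ltnP => [lt_kn|_]; last by rewrite mulr0.
have le_kn : (k <= n)%N by [].
apply: (canRL (mulKf E_neq0)); rewrite coef_epoly // (ecoef_bigffadd _ _ le_kn (ltnSn k)).
have -> : ecoef n q0 k =
    D ord0 1 * ('C(n, k)%:R * (rising_seq (a ord0) k / rising_seq (b ord0) k)).
  by rewrite /q0 -[(-1) ^+ _]divr1 ecoefE ?oner_eq0 // expr1n mulr1.
(* As [n ^_ m] is ['C(n, m) * m!], normalising leaves the [1 / m!] of the inner sum. *)
have qE (l : 'I_r) : \poly_(m < k.+1) (ecoef n (q l) m / (n ^_ m)%:R) =
    D (lift ord0 l) (c (lift ord0 l)) *: \poly_(m < k.+1)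
      (rising_seq (a (lift ord0 l)) m /
         (rising_seq (b (lift ord0 l)) m * (m`!)%:R) * c (lift ord0 l) ^+ m).
  apply/polyP => m; rewrite coefZ !coef_poly; case: ltnP => [lt_mk|_]; last first.
    by rewrite mulr0.
  have le_mn : (m <= n)%N by rewrite (leq_trans _ le_kn).
  rewrite ecoefE // -bin_ffact natrM; move: (D _ _) => Dl.
  have bin0 : 'C(n, m)%:R != 0 :> R by rewrite pnatr_eq0 -lt0n bin_gt0.
  have fact0 : (m`!)%:R != 0 :> R by rewrite pnatr_eq0 -lt0n fact_gt0.
  have b0 := rising_seq_neq0 (b_ok (lift ord0 l)) le_mn.
  by field; rewrite bin0 fact0 b0.
rewrite (eq_bigr _ (fun l _ => qE l)).
(* The binomial of [q0] cancels the one in [ffmul]; the sign from [coef_epoly] and the [n ^_ k] from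
   [ffadd] form [rising (- n%:R) k]. *)
rewrite scaler_prod coefZ coef_prod_poly rising_oppn // /E.
have bin0 : 'C(n, k)%:R != 0 :> R by rewrite pnatr_eq0 -lt0n bin_gt0.
have b0 := rising_seq_neq0 (b_ok ord0) le_kn.
by field; rewrite bin0 b0.
Qed.
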